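(* Let $S=(I_A,I_F,M,O)$ be a canonical Local Friendliness scenario. If $\mathcal{LF}(S)=\mathcal{B}(S)$, then at least one of the following holds: (a) $|I_F|=|I_A|-1$ and $|M_j|=2$ for all $j\in I_F$; (b) $I_F=I_A$ and $|M_i|=2$ for at least $|I_A|-1$ of the parties $i\in I_A$.
   Context: Canonical (standard) Local Friendliness (LF) scenario: a quadruple $S=(I_A,I_F,M,O)$ where $I_A=\{1,\dots,N\}$ is a finite set of parties (superobservers), $I_F\subset I_A$ (possibly empty, possibly all of $I_A$) is the set of parties having a ''friend'', $M=M_1\times\dots\times M_N$ with $M_i=\{1,\dots,m_i\}$ the finite set of measurement settings of party $i$, and for each $i$ and $x_i\in M_i$ there is a finite outcome set $O_{x_i}$ (depending on $i$ and on the setting $x_i$); for $\vec x\in M$ put $O_{\vec x}=O_{x_1}\times\dots\times O_{x_N}$, and $O=\{O_{\vec x}\}_{\vec x\in M}$. The sets $I_A$, $M_i$, $O_{x_i}$ all have cardinality at least 2. The symbol $\subset$ denotes non-strict inclusion. For $J\subset I_A$, $\vec a_J$ and $\vec x_J$ denote the substrings indexed by $J$. Behaviour: a family $\wp=(\wp(\cdot|\vec x))_{\vec x\in M}$ where $\wp(\cdot|\vec x)$ is a probability distribution on $O_{\vec x}$. $\mathcal{B}(S)$: the set of behaviours admitting a local hidden variable (LHV) model, i.e. $\wp(\vec a|\vec x)=\int_\Lambda d\lambda\,p(\lambda)\prod_{i=1}^N P(a_i|x_i,\lambda)$ for all $\vec a,\vec x$, for some probability space $(\Lambda,p)$ and,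 for each $i$, $x_i$, $\lambda$, a probability distribution $P(\cdot|x_i,\lambda)$ on $O_{x_i}$. $\mathcal{LF}(S)$: the set of behaviours $\wp$ for which there exist a probability distribution $P(\vec c)$ on strings $\vec c=(c_i)_{i\in I_F}\in\prod_{i\in I_F}O_{x_i=1}$ (here $O_{x_i=1}$ is the outcome set of party $i$'s setting $1$) and, for each $\vec c$ and $\vec x\in M$, a probability distribution $P(\cdot|\vec x,\vec c)$ on $O_{\vec x}$, such that: (1) $\wp(\vec a|\vec x)=\sum_{\vec c}P(\vec a|\vec x,\vec c)P(\vec c)$; (2) (Local Agency) for every $V\subset I_A$ the marginal $P(\vec a_V|\vec x,\vec c)$ depends on $\vec x$ only through $\vec x_V$; (3) with $F_{\vec x}=\{i\in I_F: x_i=1\}$, $P(\vec a_{F_{\vec x}}|\vec x,\vec c)=\prod_{i\in F_{\vec x}}\delta_{a_i,c_i}$. Equivalently $\wp(\vec a|\vec x)=\sum_{\vec c}\prod_{i\in F_{\vec x}}\delta_{a_i,c_i}\,P(\vec a_{J_{\vec x}}|\vec x_{J_{\vec x}},\vec c)\,P(\vec c)$ with $J_{\vec x}=I_A\setminus F_{\vec x}$, the $P(\cdot|\cdot,\vec c)$ satisfying Local Agency. If $I_F=\emptyset$, $\vec c$ is the empty string. *)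

(* Defs.v *)
From HB Require Import structures.
From mathcomp Require Import all_boot all_order all_algebra.
From mathcomp Require Import all_classical all_reals all_analysis.

Set Implicit Arguments.
Unset Strict Implicit.
Unset Printing Implicit Defensive.

Import Order.TTheory GRing.Theory Num.Theory.

Local Open Scope classical_set_scope.
Local Open Scope ring_scope.

(* Parties and settings are numbered from 0, so the privileged setting
   "x_i = 1" is the ordinal of value 0. *)
Record scenario := Scenario {
  n_parties : nat;
  friends : {set 'I_n_parties};
  n_settings : 'I_n_parties -> nat;
  outcome : forall i : 'I_n_parties, 'I_(n_settings i) -> finType;
  n_parties_ge2 : (2 <= n_parties)%N;
  n_settings_ge2 : forall i, (2 <= n_settings i)%N;
  card_outcome_ge2 : forall i (s : 'I_(n_settings i)), (2 <= #|outcome s|)%N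
}.
Arguments outcome : clear implicits.
Arguments outcome S i s : rename.

Definition setting1 (S : scenario) (i : 'I_(n_parties S)) :
  'I_(n_settings i) := Ordinal (ltnW (n_settings_ge2 i)).

Definition settings (S : scenario) :=
  {dffun forall i : 'I_(n_parties S), 'I_(n_settings i)}.

Definition outcomes (S : scenario) (x : settings S) :=
  {dffun forall i : 'I_(n_parties S), outcome S i (x i)}.

Definition friend (S : scenario) :=
  {i : 'I_(n_parties S) | i \in friends S}.

Definition friend_outcomes (S : scenario) :=
  {dffun forall u : friend S, outcome S (sval u) (setting1 (sval u))}.

(* Outcomes of party i for possibly different settings live in different
   types; they are compared as (setting, outcome) pairs. *)
Definition tagged_outcome (S : scenario) (i : 'I_(n_parties S))
    (s : 'I_(n_settings i)) (a : outcome S i s) :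
  {s : 'I_(n_settings i) & outcome S i s} :=
  Tagged (fun s => outcome S i s : Type) a.

Section Behaviours.
Context (R : realType).

Definition is_distr (T : finType) (p : T -> R) :=
  (forall a, 0 <= p a) /\ \sum_a p a = 1.

Definition cond_family (S : scenario) := forall x : settings S, outcomes x -> R.

Definition is_behaviour (S : scenario) (wp : cond_family S) :=
  forall x, is_distr (wp x).

Definition marginal (S : scenario) (x : settings S) (p : outcomes x -> R)
    (V : {set 'I_(n_parties S)}) (a : outcomes x) : R :=
  \sum_(b : outcomes x | [forall i in V, b i == a i]) p b.

(* The hypothesis on a and a' says that x_V = x'_V and a_V = a'_V. *)
Definition local_agency (S : scenario) (P : cond_family S) :=
  forall (V : {set 'I_(n_parties S)}) (x x' : settings S)
    (a : outcomes x) (a' : outcomes x'),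
    (forall i, i \in V -> tagged_outcome (a i) = tagged_outcome (a' i)) ->
    marginal (P x) V a = marginal (P x') V a'.

(* F_x, the parties that merely open the lab and read their friend's record. *)
Definition opened (S : scenario) (x : settings S) : {set 'I_(n_parties S)} :=
  [set i in friends S | x i == setting1 i]%SET.

Definition LF (S : scenario) : set (cond_family S) :=
  [set wp | is_behaviour wp /\
    exists (Pc : friend_outcomes S -> R) (P : friend_outcomes S -> cond_family S),
      [/\ is_distr Pc,
          forall c, is_behaviour (P c),
          forall x a, wp x a = \sum_c P c x a * Pc c,
          forall c, local_agency (P c)
        & forall c x a,
            marginal (P c x) (opened x) a =
            \prod_(u : friend S | sval u \in opened x)
              (tagged_outcome (a (sval u)) == tagged_outcome (c u))%:R]].

(* Measurability in the hidden variable is what gives the integral a meaning. *)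
Definition Bell (S : scenario) : set (cond_family S) :=
  [set wp | is_behaviour wp /\
    exists (d : measure_display) (Lambda : measurableType d)
      (p : probability Lambda R)
      (P : forall i (s : 'I_(n_settings i)), Lambda -> outcome S i s -> R),
      [/\ forall i s l, is_distr (P i s l),
          forall i s b, measurable_fun setT (fun l => P i s l b)
        & forall x a,
            (wp x a)%:E = (\int[p]_l (\prod_i P i (x i) l (a i))%:E)%E]].

End Behaviours.

Arguments LF R S : clear implicits.
Arguments Bell R S : clear implicits.

(* Main.v *)
Require Import Defs.
From mathcomp Require Import all_boot all_order all_algebra.
From mathcomp Require Import all_classical all_reals all_analysis.
From mathcomp Require Import measurable_realfun.

(** Call a party free if it has two settings at which no friend's record is
    read: it has no friend, or it has at least three settings. If neither (a)
    nor (b) holds there are two free parties, and a Popescu-Rohrlich box played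
    on their free settings, all other answers being fixed by the records c, is
    a Local Friendliness behaviour. It is not Bell: an LHV model has a value of
    the hidden variable that gives probability 0 to all the (finitely many)
    impossible events, hence yields predetermined answers that are possible in
    every context, whereas the PR box admits none. *)

Set Implicit Arguments.
Unset Strict Implicit.
Unset Printing Implicit Defensive.

Import Order.TTheory GRing.Theory Num.Theory.

Local Open Scope ring_scope.

(** * Indicator sums, and predetermined answers in LHV models *)

Lemma sum_indic (R : pzSemiRingType) (T : finType) (P : pred T) (y : T) :
  \sum_(b | P b) (b == y)%:R = (P y)%:R :> R.
Proof.
rewrite big_mkcond (bigD1 y) //= eqxx big1 ?addr0; first by case: (P y).
by move=> b /negbTE->; case: (P b).
Qed.

Lemma prod_indic (R : comPzSemiRingType) (T : finType) (P Q : pred T) :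
  \prod_(u | P u) (Q u)%:R = [forall (u | P u), Q u]%:R :> R.
Proof.
case: forallP => [PQ|/forallP/forallPn[u]].
  by rewrite big1 // => u Pu; have := PQ u; rewrite Pu /= => ->.
by rewrite negb_imply => /andP[Pu /negbTE Qu]; rewrite (bigD1 u) //= Qu mul0r.
Qed.

Lemma is_distr_gt0 (R : realType) (T : finType) (p : T -> R) :
  is_distr p -> exists a, 0 < p a.
Proof.
case=> p_ge0 p1; apply: contrapT => p_le0.
have : \sum_a p a = 0.
  apply: big1 => a _; apply/eqP; rewrite eq_le p_ge0 andbT leNgt.
  by apply/negP => pa; apply: p_le0; exists a.
by rewrite p1 => /eqP; rewrite oner_eq0.
Qed.

Lemma Bell_predetermined (R : realType) (S : scenario) (wp : cond_family R S) :
  Bell R S wp ->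
  exists g : forall i (s : 'I_(n_settings i)), outcome S i s,
    forall x : settings S, wp x [ffun i => g i (x i)] != 0.
Proof.
case=> _ [d [L [p [P [Pd Pm wpE]]]]].
have possible x : \forall l \ae p, forall a : outcomes x,
    wp x a = 0 -> \prod_i P i (x i) l (a i) = 0.
  apply: filter_forall => a.
  have [wp0|wpN0] := eqVneq (wp x a) 0; last first.
    by apply: aeW => l /eqP; rewrite (negbTE wpN0).
  have prod_ge0 l : 0 <= \prod_i P i (x i) l (a i).
    by apply: prodr_ge0 => i _; case: (Pd i (x i) l).
  pose prod_P (l : L) : R := \prod_i P i (x i) l (a i).
  have mprod : measurable_fun setT (EFin \o prod_P).
    by apply/measurable_EFinP; apply: measurable_prod => i _; exact: Pm.
  have := wpE x a; rewrite wp0 => /esym int0.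
  (* A nonnegative integrand with integral 0 vanishes almost everywhere. *)
  have /(ae_eq_integral_abs p measurableT mprod) :
      (\int[p]_(l in setT) `|(EFin \o prod_P) l| = 0)%E.
    rewrite -[RHS]int0; apply: eq_integral => l _.
    by rewrite /= ger0_norm ?prod_ge0.
  by apply: filterS => l /(_ I)/= [].
have {possible} : \forall l \ae p, forall (x : settings S) (a : outcomes x),
    wp x a = 0 -> \prod_i P i (x i) l (a i) = 0 by exact: filter_forall.
(* [p] has total mass 1, so what holds almost everywhere holds at some [l]. *)
have ae_proper : ProperFilter (almost_everywhere p).
  apply: ae_properfilter_algebraOfSetsType.
  by rewrite [X in (_ < X)%E]probability_setT lte_fin ltr01.
move=> /filter_ex[l wp0P].
have supp i s : {b | 0 < P i s l b}.
  exact/cid/is_distr_gt0.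
(* Outcomes of positive probability at [l] have a positive product in every context, so none of
   these events is impossible. *)
exists (fun i s => sval (supp i s)) => x; apply/eqP => /wp0P/eqP.
apply/negP; rewrite gt_eqF //; apply: prodr_gt0 => i _.
by rewrite ffunE; case: supp.
Qed.

(** * Free settings and answers read from records *)

Section Scenario.
Variable S : scenario.
Implicit Types (i j k : 'I_(n_parties S)) (x : settings S).

Definition bit_outcome k (s : 'I_(n_settings k)) (b : bool) : outcome S k s :=
  enum_val (widen_ord (card_outcome_ge2 s) (inord b)).

Lemma bit_outcome_inj k (s : 'I_(n_settings k)) : injective (bit_outcome s).
Proof.
move=> b b' /enum_val_inj/(congr1 val) /=.
by rewrite !inordK ?ltnS ?leq_b1 //; case: b; case: b'.
Qed.

Lemma tagged_outcome_eq k (s : 'I_(n_settings k)) (a b : outcome S k s) :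
  (tagged_outcome a == tagged_outcome b) = (a == b).
Proof. exact: eq_Tagged. Qed.

Definition free k := (k \notin friends S) || (2 < n_settings k)%N.

(** With three or more settings the values 1 and 2 are used, which avoids the privileged value 0.
    With only two settings, 0 is used as well; this is harmless for a free party, which then has no
    friend. *)
Definition free_setting k (b : bool) : 'I_(n_settings k) :=
  if ltnP 2 (n_settings k) is LtnNotGeq h
  then widen_ord h (inord b.+1) else widen_ord (n_settings_ge2 k) (inord b).

Lemma free_setting_inj k : injective (free_setting k).
Proof.
rewrite /free_setting => b b'.
case: ltnP => h /(congr1 val) /=;
  by rewrite !inordK ?ltnS ?leq_b1 //; case: b; case: b'.
Qed.

Lemma free_setting_neq1 k b :
  free k -> k \in friends S -> free_setting k b != setting1 k.
Proof.
rewrite /free /free_setting => /orP[/negbTE->//|k3 _].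
case: ltnP => [h|]; last by rewrite leqNgt k3.
by rewrite -val_eqE /= inordK // ltnS; case: b.
Qed.

Definition recorded (c : friend_outcomes S) k :
    forall s : 'I_(n_settings k), outcome S k s :=
  if boolP (k \in friends S) is AltTrue kF
  then dfwith (fun s => bit_outcome s false) (setting1 k) (c (exist _ k kF))
  else fun s => bit_outcome s false.

Lemma recorded1 c (u : friend S) :
  recorded c (setting1 (sval u)) = c u.
Proof.
case: u => k kF /=; rewrite /recorded.
case: {-}_ / boolP => [kF'|]; last by rewrite kF.
by rewrite (bool_irrelevance kF' kF) dfwithin.
Qed.

(** * The Popescu-Rohrlich box on two parties *)

Section Box.
Variables (R : realType) (i j : 'I_(n_parties S)).
Hypothesis neq_ij : i != j.
Implicit Type h : forall k (s : 'I_(n_settings k)), outcome S k s.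

Definition both_true x : bool :=
  (x i == free_setting i true) && (x j == free_setting j true).

(** Here [r] is the shared uniform bit: at free settings the answers of [i] and [j] have as
    exclusive or the conjunction of the two inputs. *)
Definition box_answer h (r : bool) x : outcomes x :=
  [ffun k => if (k \in [:: i; j]) && (x k \in codom (free_setting k))
             then bit_outcome (x k) (r (+) ((k == j) && both_true x))
             else h k (x k)].

Definition box h : cond_family R S :=
  fun x a => 2^-1 * \sum_r (a == box_answer h r x)%:R.
Arguments box : clear implicits.

Lemma marginal_box h x V (a : outcomes x) :
  marginal (box h x) V a =
  2^-1 * \sum_r [forall k in V, box_answer h r x k == a k]%:R.
Proof.
rewrite /marginal -mulr_sumr exchange_big /=; congr (_ * _).
by apply: eq_bigr => r _; rewrite sum_indic.
Qed.

Lemma half_sum_bool : 2^-1 * \sum_(r : bool) 1 = 1 :> R.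
Proof. by rewrite sumr_const card_bool mulVf // pnatr_eq0. Qed.

Lemma box_behaviour h : is_behaviour (box h).
Proof.
move=> x; split=> [a|].
  by rewrite mulr_ge0 ?invr_ge0 ?ler0n // sumr_ge0.
rewrite -mulr_sumr exchange_big /= -[RHS]half_sum_bool; congr (_ * _).
by apply: eq_bigr => r _; rewrite sum_indic.
Qed.

(* If V misses i, the correlation only shifts the uniform bit r; otherwise the
   answers in V are a function of r and x_V. *)
Lemma box_local_agency h : local_agency (box h).
Proof.
move=> V x x' a a' eqa; rewrite !marginal_box; congr (_ * _).
have eqx k : k \in V -> x k = x' k by move=> /eqa/(congr1 (@tag _ _)).
pose d := (i \notin V) && (both_true x (+) both_true x').
rewrite [RHS](reindex_inj (@addIb d)) /=; apply: eq_bigr => r _.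
congr (nat_of_bool _)%:R; apply: eq_forallb => k.
case: (boolP (k \in V)) => //= kV.
have eq_ans : tagged_outcome (box_answer h r x k) =
              tagged_outcome (box_answer h (r (+) d) x' k).
  rewrite !ffunE (eqx _ kV); case: ifP => // /andP[kij _].
  congr (tagged_outcome (bit_outcome _ _)).
  have [iV|iV] := boolP (i \in V); rewrite /d.
    rewrite iV /= addbF; congr (_ (+) _); have [kj|//] := eqVneq k j.
    by rewrite /both_true -kj !eqx.
  rewrite iV /=; move: kij; rewrite !inE; have [ki|_ /= kj] := eqVneq k i.
    by rewrite -ki kV in iV.
  by rewrite kj /=; case: r; case: (both_true x); case: (both_true x').
by rewrite -!tagged_outcome_eq eq_ans eqa.
Qed.

Hypotheses (free_i : free i) (free_j : free j).

(** A free party that has a friend is never opened at a free setting. So all opened parties answer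
    from the records whatever [r] is, and both sides are the indicator of the same event. *)
Lemma box_opened c x (a : outcomes x) :
  marginal (box (recorded c) x) (opened x) a =
  \prod_(u : friend S | sval u \in opened x)
    (tagged_outcome (a (sval u)) == tagged_outcome (c u))%:R.
Proof.
rewrite marginal_box prod_indic -[RHS]mulr1 -[X in _ = _ * X]half_sum_bool.
rewrite mulrCA [X in _ = _ * X]mulr_sumr; congr (_ * _); apply: eq_bigr => r _; rewrite mulr1.
have ansE (u : friend S) : sval u \in opened x ->
    (box_answer (recorded c) r x (sval u) == a (sval u)) =
    (tagged_outcome (a (sval u)) == tagged_outcome (c u)).
  rewrite inE => /andP[uF /eqP xu].
  rewrite -recorded1 -xu tagged_outcome_eq eq_sym ffunE ifF //.
  apply/negP => /andP[uij /codomP[b xb]].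
  have free_u : free (sval u) by move: uij; rewrite !inE => /orP[]/eqP->.
  by have := free_setting_neq1 b free_u uF; rewrite -xb xu eqxx.
congr (nat_of_bool _)%:R; apply/forall_inP/forall_inP => [ans u uo|ans k ko].
  by rewrite -ansE //; exact: ans.
have kF : k \in friends S by move: ko; rewrite inE => /andP[].
by have := ansE (exist _ k kF) ko => /= ->; exact: (ans (exist _ k kF)).
Qed.

Definition false_records : friend_outcomes S :=
  [ffun u => bit_outcome (setting1 (sval u)) false].

Lemma box_LF : LF R S (box (recorded false_records)).
Proof.
split; first exact: box_behaviour.
(* The records follow a point mass; at every other [c], of weight 0, the box must still agree with
   the records [c]. *)
exists (fun c => (c == false_records)%:R), (fun c => box (recorded c)); split.
- by split=> [c|]; rewrite ?ler0n // sum_indic.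
- by move=> c; exact: box_behaviour.
- move=> x a; rewrite (bigD1 false_records) //= eqxx mulr1 big1 ?addr0 //.
  by move=> c /negbTE->; rewrite mulr0.
- by move=> c; exact: box_local_agency.
- exact: box_opened.
Qed.

Lemma box_not_Bell h : ~ Bell R S (box h).
Proof.
move=> /Bell_predetermined[g g_possible].
have predetermined x : exists r, forall k,
    k \in [:: i; j] -> x k \in codom (free_setting k) ->
    g k (x k) = bit_outcome (x k) (r (+) ((k == j) && both_true x)).
  have [r gE] : exists r, [ffun k => g k (x k)] = box_answer h r x.
    apply: contrapT => no_r; have /eqP := g_possible x; apply.
    rewrite /box big1 ?mulr0 // => r _.
    by case: eqP => // gE; case: no_r; exists r.
  exists r => k kij xk; have := congr1 (fun a : outcomes x => a k) gE.
  by rewrite !ffunE kij xk.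
(* The four contexts of the box; the settings of the remaining parties are arbitrary. *)
pose ctx u v : settings S :=
  [ffun k => dfwith (dfwith (@setting1 S) i (free_setting i u))
                    j (free_setting j v) k].
have ctx_i u v : ctx u v i = free_setting i u.
  by rewrite ffunE dfwithout 1?eq_sym // dfwithin.
have ctx_j u v : ctx u v j = free_setting j v by rewrite ffunE dfwithin.
have answers u v : exists r,
    g i (free_setting i u) = bit_outcome (free_setting i u) r /\
    g j (free_setting j v) = bit_outcome (free_setting j v) (r (+) (u && v)).
  have [r gE] := predetermined (ctx u v).
  have both_ctx : both_true (ctx u v) = u && v.
    rewrite /both_true ctx_i ctx_j !(inj_eq (@free_setting_inj _)).
    by rewrite !eqb_id.
  exists r; split.
    have := gE i; rewrite ctx_i (negbTE neq_ij) addbF; apply.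
      exact: mem_head.
    exact: codom_f.
  have := gE j; rewrite ctx_j both_ctx eqxx; apply; last exact: codom_f.
  by rewrite !inE eqxx orbT.
have [r00 [i00 j00]] := answers false false.
have [r01 [i01 j01]] := answers false true.
have [r10 [i10 j10]] := answers true false.
have [r11 [i11 j11]] := answers true true.
(* An answer of [g] depends only on its own setting. Comparing contexts gives [r00 = r01],
   [r10 = r11], [r00 = r10] and, because of the flip, [r01 = ~~ r11]: a contradiction. *)
move: i01 i11 j10 j11; rewrite i00 i10 j00 j01.
move=> /bit_outcome_inj e1 /bit_outcome_inj e2.
move=> /bit_outcome_inj e3 /bit_outcome_inj e4.
move: e1 e2 e3 e4 {i00 j00 j01 i10}.
by case: r00; case: r01; case: r10; case: r11.
Qed.

End Box.
End Scenario.

Theorem theorem18 (R : realType) (S : scenario) :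
  LF R S = Bell R S ->
  (#|friends S| = (n_parties S - 1)%N /\
     (forall j, j \in friends S -> n_settings j = 2%N)) \/
  (friends S = [set: 'I_(n_parties S)]%SET /\
     (n_parties S - 1 <= #|[set i : 'I_(n_parties S) | n_settings i == 2%N]%SET|)%N).
Proof.
move=> LF_Bell.
have free_unique (i j : 'I_(n_parties S)) : free i -> free j -> i = j.
  move=> fi fj; apply/eqP/negPn/negP => neq_ij.
  have := box_LF R fi fj; rewrite LF_Bell; exact: box_not_Bell.
have settings2 (k : 'I_(n_parties S)) : ~~ free k -> n_settings k = 2%N.
  rewrite /free negb_or -leqNgt => /andP[_ k2].
  by apply/eqP; rewrite eqn_leq k2 n_settings_ge2.
have [all_friends|/eqP] := eqVneq (friends S) [set: 'I_(n_parties S)]%SET.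
  right; split=> //.
  pose A := [set i : 'I_(n_parties S) | n_settings i == 2%N]%SET.
  (* Any party outside [A] is free, and there is at most one free party. *)
  have : (#|~: A| <= 1)%N.
    apply/card_le1_eqP => k l; rewrite !inE => k2 l2.
    by apply: free_unique; apply/negPn/negP => /settings2/eqP; exact/negP.
  by move=> A1; rewrite [leqRHS]cardsCs card_ord leq_sub2l.
move=> /eqP; rewrite -properT => /properP[_ [k _ kF]]; left.
(* A party without a friend is free, hence the only free one: all others have a friend and exactly
   two settings. *)
have fk : free k by rewrite /free kF.
split; last first.
  move=> j jF; apply: settings2; apply/negP => /(free_unique _ _ fk) kj.
  by rewrite kj jF in kF.
have -> : friends S = [set~ k]%SET.
  apply/setP => j; rewrite !inE; have [->|neq_jk] := eqVneq j k.
    exact/negbTE.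
  apply/negPn/negP => jF; case/eqP: neq_jk; apply: free_unique => //.
  by rewrite /free jF.
by rewrite cardsC1 card_ord subn1.
Qed.
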